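(* For every integer $b\ge 2$ and every $0<\alpha<1$ there exist $d\in\mathbb{N}$ and Lipschitz functions $g_0,\dots,g_{d-1}\colon\mathbb{S}^1\to\mathbb{R}$ such that the Weierstrass embedding $\Phi=\Phi^{\alpha,b}_{\{g_0,\dots,g_{d-1}\}}\colon\mathbb{S}^1\to\mathbb{R}^d$ is $\alpha$-bi-Hölder, i.e. there are constants $c_1,c_2>0$ with $$c_1|x-y|^\alpha\le\|\Phi(x)-\Phi(y)\|\le c_2|x-y|^\alpha\quad\text{for all } x,y\in[0,1).$$
   Context: $\mathbb{S}^1$ is identified with $\mathbb{R}/\mathbb{Z}$ (points represented in $[0,1)$), and functions on $\mathbb{S}^1$ are $1$-periodic functions on $\mathbb{R}$. For an integer $b\ge2$, $0<\alpha<1$ and a Lipschitz $g\colon\mathbb{S}^1\to\mathbb{R}$, $W_g^{\alpha,b}(x)=\sum_{k=0}^\infty b^{-\alpha k}g(b^kx)$. For a finite collection $\mathcal{G}=\{g_0,\dots,g_{d-1}\}$ of Lipschitz functions on $\mathbb{S}^1$, the Weierstrass embedding is $\Phi^{\alpha,b}_{\mathcal{G}}(x)=(W^{\alpha,b}_{g_0}(x),\dots,W^{\alpha,b}_{g_{d-1}}(x))\in\mathbb{R}^d$. $\|\cdot\|$ is the $\ell^\infty$ norm on $\mathbb{R}^d$.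
   Formalization: The distance |x-y| is replaced by the circle distance min(|x-y|, 1-|x-y|), since with the ordinary |x-y| the lower bound fails: Φ is continuous and 1-periodic, so Φ(0)-Φ(y) tends to 0 as y tends to 1. The trivial case x = y is left out. *)

(* Defs.v *)
From Stdlib Require Import Reals Lra List.
From Coquelicot Require Import Coquelicot.
Open Scope R_scope.

(* A function on S^1 = R/Z is a 1-periodic function on R. *)
Definition periodic1 (g : R -> R) : Prop := forall x, g (x + 1) = g x.

(* Lipschitz continuity (w.r.t. the usual metric; for 1-periodic g this is
   equivalent to Lipschitz on S^1 with the quotient metric). *)
Definition lipschitz (g : R -> R) : Prop :=
  exists L, forall x y, Rabs (g x - g y) <= L * Rabs (x - y).

Definition W (alpha : R) (b : nat) (g : R -> R) (x : R) : R :=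
  Series (fun k : nat => Rpower (INR b) (- alpha * INR k) * g (INR b ^ k * x)).

Definition Phi (alpha : R) (b : nat) (gs : nat -> R -> R) (x : R) : nat -> R :=
  fun i => W alpha b (gs i) x.

Definition linf (d : nat) (v : nat -> R) : R :=
  fold_right Rmax 0 (map (fun i => Rabs (v i)) (seq 0 d)).

Definition circ_dist (x y : R) : R := Rmin (Rabs (x - y)) (1 - Rabs (x - y)).

(* Main.v *)
(** Let [R_M] be the nondecreasing function with [R_M (x + 1) = R_M x + 1] that climbs from
    [0] to [1] on [[0, 1/M]] and is flat on [[1/M, 1]]. The functions
    [g_i x = R_M (x - i/M) - (x - i/M)], [i < M], rise steeply on one short arc but never
    fall with slope below [-1]. So if [d = v - u > 0], every term of [W g_i v - W g_i u] is
    at least [- b^(-alpha k) min (1, b^k d)], and these lower bounds sum to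
    [- C d^alpha] with [C] independent of [M]. If moreover [b^j d] lies in [[2/M, 2b/M]],
    then [[b^j u, b^j v]] contains, modulo 1, the steep arc of some [g_i], and the [j]-th
    term gains the positive amount [b^(-alpha j) >= (M/2b)^alpha d^alpha], which dominates
    once [M] is large. Distances [d >= 2/M] are separated by the functions [g_i] themselves,
    since [g_i] is the Weierstrass function of [x |-> g_i x - b^(-alpha) g_i (b x)]. *)

Require Import Defs.
From Stdlib Require Import Reals Lra Lia ZArith List.
From Coquelicot Require Import Coquelicot.
Open Scope R_scope.

(** * Maximum norm, series and real powers *)

Lemma Rabs_le_linf (d : nat) (v : nat -> R) (i : nat) :
  (i < d)%nat -> Rabs (v i) <= linf d v.
Proof.
intros Hi; unfold linf.
assert (Hin : In i (seq 0 d)) by (apply in_seq; lia).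
induction (seq 0 d) as [|k s IH]; simpl in *; [easy|].
destruct Hin as [-> | Hin]; [apply Rmax_l|].
eapply Rle_trans; [apply IH, Hin | apply Rmax_r].
Qed.

Lemma linf_le (d : nat) (v : nat -> R) (B : R) :
  0 <= B -> (forall i, (i < d)%nat -> Rabs (v i) <= B) -> linf d v <= B.
Proof.
intros HB Hv; unfold linf.
assert (Hs : forall i, In i (seq 0 d) -> Rabs (v i) <= B)
  by (intros i Hi; apply in_seq in Hi; apply Hv; lia).
induction (seq 0 d) as [|k s IH]; simpl in *; [easy|].
apply Rmax_lub; auto.
Qed.

Lemma le_Series (a : nat -> R) (j : nat) :
  ex_series a -> (forall k, 0 <= a k) -> a j <= Series a.
Proof.
intros Ha Hpos.
apply Rle_trans with (sum_n a j).
- destruct j as [|j]; [rewrite sum_O; lra|].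
  rewrite sum_Sn; unfold plus; simpl.
  assert (0 <= sum_n a j); [|lra].
  rewrite sum_n_Reals; apply cond_pos_sum, Hpos.
- apply (is_lim_seq_incr_compare (sum_n a)); [exact (Series_correct _ Ha)|].
  intros n; rewrite sum_Sn; unfold plus; simpl; specialize (Hpos (S n)); lra.
Qed.

Lemma Series_le_bound (a : nat -> R) (B : R) :
  ex_series a -> (forall n, sum_f_R0 a n <= B) -> Series a <= B.
Proof.
intros Ha HB.
apply (is_lim_seq_le (sum_n a) (fun _ => B) (Series a) B).
- intros n; rewrite sum_n_Reals; apply HB.
- exact (Series_correct _ Ha).
- apply is_lim_seq_const.
Qed.

Lemma ex_series_geom_bounded (q B : R) (f : nat -> R) :
  0 < q < 1 -> (forall k, Rabs (f k) <= B) -> ex_series (fun k => q ^ k * f k).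
Proof.
intros Hq Hf.
apply (@ex_series_le R_AbsRing R_CompleteNormedModule _ (fun k => q ^ k * B)).
- intros k; unfold norm; simpl; unfold abs; simpl.
  rewrite Rabs_mult, (Rabs_pos_eq (q ^ k)) by (apply pow_le; lra).
  apply Rmult_le_compat_l; [apply pow_le; lra | apply Hf].
- apply ex_series_scal_r, ex_series_geom; rewrite Rabs_pos_eq; lra.
Qed.

Lemma Rpower_pow_base (b a : R) (k : nat) :
  0 < b -> Rpower b (a * INR k) = Rpower b a ^ k.
Proof. intros Hb; rewrite <- Rpower_mult, Rpower_pow; [easy | apply exp_pos]. Qed.

Lemma Rpower_base_lt_1 (b a : R) : 1 < b -> 0 < a -> 0 < Rpower b (- a) < 1.
Proof.
intros Hb Ha; split; [apply exp_pos|].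
rewrite <- (Rpower_O b) by lra; apply Rpower_lt; lra.
Qed.

Lemma Rpower_between (d a : R) : 0 < d < 1 -> 0 < a < 1 -> d < Rpower d a < 1.
Proof.
intros Hd Ha.
assert (ln d < 0) by (rewrite <- ln_1; apply ln_increasing; lra).
split.
- rewrite <- (Rpower_1 d) at 1 by lra; apply exp_increasing; nra.
- rewrite <- exp_0; apply exp_increasing; nra.
Qed.

(** * Periodic functions and distance on the circle *)

Lemma periodic1_INR (g : R -> R) (n : nat) (x : R) :
  periodic1 g -> g (x + INR n) = g x.
Proof.
intros Hg; induction n as [|n IH]; [now rewrite Rplus_0_r|].
now rewrite S_INR, <- Rplus_assoc, Hg.
Qed.

Lemma W_periodic (alpha : R) (b : nat) (g : R -> R) :
  periodic1 g -> periodic1 (W alpha b g).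
Proof.
intros Hg x; unfold W; apply Series_ext; intros k; f_equal.
rewrite Rmult_plus_distr_l, Rmult_1_r, <- pow_INR.
now apply periodic1_INR.
Qed.

(** The points [u < v] are lifts to the line of the ends of the shorter arc, so that all later
    estimates can be made for ordered reals. *)
Lemma circ_dist_lift (x y : R) :
  0 <= x < 1 -> 0 <= y < 1 -> x <> y ->
  exists u v, 0 < v - u <= 1 / 2 /\ circ_dist x y = v - u /\
    forall f, periodic1 f -> Rabs (f x - f y) = Rabs (f v - f u).
Proof.
assert (Hlt : forall x y, 0 <= x < 1 -> 0 <= y < 1 -> x < y ->
  exists u v, 0 < v - u <= 1 / 2 /\ circ_dist x y = v - u /\
    forall f, periodic1 f -> Rabs (f x - f y) = Rabs (f v - f u)).
{ clear x y; intros x y Hx Hy Hxy; unfold circ_dist.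
  rewrite Rabs_minus_sym, Rabs_pos_eq by lra.
  destruct (Rle_lt_dec (y - x) (1 / 2)).
  - exists x, y; rewrite Rmin_left by lra; repeat split; try lra.
    intros f _; apply Rabs_minus_sym.
  (* The shorter arc passes through 0, so its right end is [x + 1]. *)
  - exists y, (x + 1); rewrite Rmin_right by lra; repeat split; try lra.
    now intros f Hf; rewrite Hf. }
intros Hx Hy Hxy; destruct (Rtotal_order x y) as [H | [H | H]]; [auto | lra |].
destruct (Hlt y x Hy Hx H) as (u & v & Huv & Hd & Hf).
exists u, v; split; [exact Huv|]; split.
- rewrite <- Hd; unfold circ_dist; now rewrite Rabs_minus_sym.
- intros f Hp; rewrite <- Hf by exact Hp; apply Rabs_minus_sym.
Qed.

(** Multiplying by [b] until [s] is first reached overshoots by a factor less than [b]; [N] bounds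
    the number of steps and carries the induction. *)
Lemma scale_between (b s : R) (N : nat) (d : R) :
  1 < b -> d < s -> s <= b ^ N * d -> exists j, s <= b ^ j * d < b * s.
Proof.
intros Hb; revert d; induction N as [|N IH]; intros d Hd HN; [simpl in HN; lra|].
destruct (Rle_lt_dec s (b * d)).
- exists 1%nat; rewrite pow_1; split; [easy|]; apply Rmult_lt_compat_l; lra.
- destruct (IH (b * d)) as [j Hj]; [easy | simpl in HN; lra |].
  exists (S j); simpl; lra.
Qed.

(** * The ramp [R_M] and the periodic teeth [g_i] *)

Definition ramp (M x : R) : R := IZR (Int_part x) + Rmin 1 (M * (x - IZR (Int_part x))).

Lemma Int_part_bounds (x : R) : IZR (Int_part x) <= x < IZR (Int_part x) + 1.
Proof. destruct (base_Int_part x); lra. Qed.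

Lemma ramp_spec (M x : R) (n : Z) :
  IZR n <= x < IZR n + 1 -> ramp M x = IZR n + Rmin 1 (M * (x - IZR n)).
Proof.
intros Hn; unfold ramp; rewrite (Int_part_spec x n); [easy | lra].
Qed.

Lemma ramp_add1 (M x : R) : ramp M (x + 1) = ramp M x + 1.
Proof.
pose proof (Int_part_bounds x).
rewrite (ramp_spec M (x + 1) (Int_part x + 1)) by (rewrite plus_IZR; lra).
unfold ramp; rewrite plus_IZR.
replace (x + 1 - (IZR (Int_part x) + 1)) with (x - IZR (Int_part x)) by ring; ring.
Qed.

Lemma ramp_bounds (M x : R) : 1 <= M -> x <= ramp M x <= x + 1.
Proof.
intros HM; pose proof (Int_part_bounds x); unfold ramp, Rmin.
destruct Rle_dec; nra.
Qed.

Lemma ramp_incr_lipschitz (M x y : R) :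
  1 <= M -> x <= y -> 0 <= ramp M y - ramp M x <= M * (y - x).
Proof.
intros HM Hxy.
pose proof (Int_part_bounds x); pose proof (Int_part_bounds y).
unfold ramp; set (m := Int_part x) in *; set (n := Int_part y) in *.
assert (Hmn : m = n \/ IZR m + 1 <= IZR n).
{ assert (m < n + 1)%Z by (apply lt_IZR; rewrite plus_IZR; lra).
  destruct (Z.eq_dec m n); [now left | right].
  rewrite <- plus_IZR; apply IZR_le; lia. }
destruct Hmn as [-> | Hmn]; unfold Rmin; do 2 destruct Rle_dec; nra.
Qed.

(** The ramp climbs from [p] to [p + 1] on [[p, p + 1/M]]; monotonicity covers the rest of
    [[u, v]]. *)
Lemma ramp_jump (M u v : R) (p : Z) :
  1 < M -> u <= IZR p -> IZR p + / M <= v -> 1 <= ramp M v - ramp M u.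
Proof.
intros HM Hu Hv.
assert (0 < / M < 1) by (split; [apply Rinv_0_lt_compat; lra |];
  rewrite <- Rinv_1; apply Rinv_lt_contravar; lra).
pose proof (ramp_incr_lipschitz M u (IZR p)).
pose proof (ramp_incr_lipschitz M (IZR p + / M) v).
assert (E1 : ramp M (IZR p) = IZR p).
{ rewrite (ramp_spec M _ p) by lra.
  rewrite Rminus_diag, Rmult_0_r, Rmin_right; lra. }
assert (E2 : ramp M (IZR p + / M) = IZR p + 1).
{ rewrite (ramp_spec M _ p) by lra.
  replace (M * (IZR p + / M - IZR p)) with 1 by (field; lra).
  rewrite Rmin_left; lra. }
lra.
Qed.

Definition tooth (M i : nat) (x : R) : R :=
  ramp (INR M) (x - INR i / INR M) - (x - INR i / INR M).

Lemma tooth_periodic (M i : nat) : periodic1 (tooth M i).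
Proof.
intros x; unfold tooth.
replace (x + 1 - INR i / INR M) with (x - INR i / INR M + 1) by ring.
rewrite ramp_add1; ring.
Qed.

Lemma tooth_bounds (M i : nat) (x : R) : 1 <= INR M -> 0 <= tooth M i x <= 1.
Proof.
intros HM; pose proof (ramp_bounds (INR M) (x - INR i / INR M) HM); unfold tooth; lra.
Qed.

(** The ramp is nondecreasing, so a fall comes only from the subtracted linear part; the caps hold
    because the values lie in [[0, 1]]. The lower bound is free of [M], unlike the upper one. *)
Lemma tooth_diff (M i : nat) (u v : R) :
  1 <= INR M -> u <= v ->
  - Rmin 1 (v - u) <= tooth M i v - tooth M i u <= INR M * Rmin 1 (v - u).
Proof.
intros HM Huv.
pose proof (tooth_bounds M i u HM); pose proof (tooth_bounds M i v HM).
pose proof (ramp_incr_lipschitz (INR M) (u - INR i / INR M) (v - INR i / INR M) HM).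
unfold tooth in *; unfold Rmin; destruct Rle_dec; nra.
Qed.

Lemma tooth_Lip (M i : nat) (x y : R) :
  1 <= INR M -> Rabs (tooth M i x - tooth M i y) <= INR M * Rabs (x - y).
Proof.
intros HM.
assert (H : forall u v, u <= v -> Rabs (tooth M i v - tooth M i u) <= INR M * (v - u)).
{ intros u v Huv; pose proof (tooth_diff M i u v HM Huv).
  pose proof (Rmin_r 1 (v - u)); apply Rabs_le; nra. }
destruct (Rle_lt_dec x y).
- rewrite Rabs_minus_sym, (Rabs_minus_sym x), (Rabs_pos_eq (y - x)) by lra; auto.
- rewrite (Rabs_pos_eq (x - y)) by lra; apply H; lra.
Qed.

Lemma tooth_jump (M : nat) (u v : R) :
  1 < INR M -> 2 / INR M <= v - u ->
  exists i, (i < M)%nat /\ 1 - (v - u) <= tooth M i v - tooth M i u.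
Proof.
intros HM Huv.
(* [z / M] is the first grid point strictly to the right of [u]. As [M (v - u) >= 2], the whole cell
   [[z/M, (z+1)/M]] lies in [[u, v]]. *)
set (z := (Int_part (INR M * u) + 1)%Z).
assert (Hz : IZR z - 1 <= INR M * u < IZR z).
{ unfold z; rewrite plus_IZR; pose proof (Int_part_bounds (INR M * u)); lra. }
assert (HMZ : (0 < Z.of_nat M)%Z) by (apply lt_IZR; rewrite <- INR_IZR_INZ; lra).
pose proof (Z.mod_pos_bound z (Z.of_nat M) HMZ) as Hmod.
(* Writing [z = M p + i] makes this cell the steep arc of tooth [i], translated by the integer
   [p]. *)
set (p := (z / Z.of_nat M)%Z); set (i := Z.to_nat (z mod Z.of_nat M)).
assert (Ez : IZR z = INR M * IZR p + INR i).
{ rewrite (Z_div_mod_eq_full z (Z.of_nat M)) at 1.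
  unfold i; rewrite plus_IZR, mult_IZR, !INR_IZR_INZ, Z2Nat.id by lia; easy. }
exists i; split; [unfold i; lia|].
assert (Hu : u - INR i / INR M <= IZR p).
{ apply (Rmult_le_reg_l (INR M)); [lra|].
  replace (INR M * (u - INR i / INR M)) with (INR M * u - INR i) by (field; lra); lra. }
assert (Hv : IZR p + / INR M <= v - INR i / INR M).
{ apply (Rmult_le_reg_l (INR M)); [lra|].
  replace (INR M * (IZR p + / INR M)) with (INR M * IZR p + 1) by (field; lra).
  replace (INR M * (v - INR i / INR M))
    with (INR M * u + INR M * (v - u) - INR i) by (field; lra).
  assert (2 <= INR M * (v - u)); [|lra].
  replace 2 with (INR M * (2 / INR M)) by (field; lra).
  apply Rmult_le_compat_l; lra. }
pose proof (ramp_jump (INR M) _ _ p HM Hu Hv); unfold tooth; lra.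
Qed.

(** The Weierstrass series of this function telescopes to [h] when [h] is bounded, so [h] itself can
    serve as a coordinate of the embedding. *)
Definition coboundary (alpha : R) (b : nat) (h : R -> R) (x : R) : R :=
  h x - Rpower (INR b) (- alpha) * h (INR b * x).

(** * Scaling identities for Weierstrass sums, with [q = b^(-alpha)] *)

Section WeierstrassSums.

Variables (b : nat) (alpha : R).
Hypothesis (Hb : (2 <= b)%nat) (Halpha : 0 < alpha < 1).

Let B := INR b.
Let q := Rpower B (- alpha).

Lemma base_ge_2 : 2 <= B.
Proof. unfold B; replace 2 with (INR 2) by (simpl; lra); now apply le_INR. Qed.

Lemma q_bounds : 0 < q < 1.
Proof. pose proof base_ge_2; apply Rpower_base_lt_1; lra. Qed.

Lemma qB_gt_1 : 1 < q * B.
Proof.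
pose proof base_ge_2; unfold q.
rewrite <- (Rpower_1 B) at 2 by lra; rewrite <- Rpower_plus.
rewrite <- (Rpower_O B) at 1 by lra; apply Rpower_lt; lra.
Qed.

(** The power [d^alpha] is invariant under replacing [f d] by [q f (B d)], the operation that shifts
    the modulus sum by one index. *)
Lemma q_Rpower_mul (d : R) : 0 < d -> q * Rpower (B * d) alpha = Rpower d alpha.
Proof.
intros Hd; pose proof base_ge_2; rewrite <- Rpower_mult_distr by lra.
unfold q; rewrite <- Rmult_assoc, <- Rpower_plus, Rplus_opp_l, Rpower_O by lra; ring.
Qed.

Lemma W_eq (g : R -> R) (x : R) : W alpha b g x = Series (fun k => q ^ k * g (B ^ k * x)).
Proof.
pose proof base_ge_2; unfold W; apply Series_ext; intros k.
fold B; unfold q; now rewrite Rpower_pow_base by lra.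
Qed.

Lemma W_coboundary (h : R -> R) (K x : R) :
  (forall x, Rabs (h x) <= K) -> W alpha b (coboundary alpha b h) x = h x.
Proof.
intros Hh; rewrite W_eq; unfold coboundary; fold B q.
assert (Ex : ex_series (fun k => q ^ k * h (B ^ k * x)))
  by (apply (ex_series_geom_bounded q K); [apply q_bounds | auto]).
rewrite (Series_ext _ (fun k => q ^ k * h (B ^ k * x)
                              - q ^ S k * h (B ^ S k * x))).
- rewrite Series_minus; [| easy | now apply (ex_series_incr_1 (fun k => q ^ k * h (B ^ k * x)))].
  rewrite (Series_incr_1 (fun k => q ^ k * h (B ^ k * x))) by easy.
  rewrite !pow_O, !Rmult_1_l; ring.
- intros k; simpl; rewrite <- (Rmult_assoc B); ring.
Qed.

(** * The sum of [q^k min (1, B^k d)] *)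

Definition modulus_const : R := / (1 - q) + B / (q * B - 1).

Lemma modulus_const_pos : 0 < modulus_const.
Proof.
pose proof base_ge_2; pose proof q_bounds; pose proof qB_gt_1.
apply Rplus_lt_0_compat; [apply Rinv_0_lt_compat | apply Rdiv_lt_0_compat]; lra.
Qed.

(* The sum [S] satisfies [S d = min (1, d) + q S (b d)]; subtracting the multiple
   [d / (q b - 1)] of [d] makes the bound reproduce itself under this recursion. *)
Lemma modulus_partial_sum (n : nat) (d : R) :
  0 < d <= B ->
  sum_f_R0 (fun k => q ^ k * Rmin 1 (B ^ k * d)) n
    <= modulus_const * Rpower d alpha - d / (q * B - 1).
Proof.
pose proof base_ge_2; pose proof q_bounds; pose proof qB_gt_1.
assert (HD : 0 < / (q * B - 1)) by (apply Rinv_0_lt_compat; lra).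
assert (HE : 1 <= / (1 - q))
  by (rewrite <- Rinv_1; apply Rinv_le_contravar; lra).
assert (Hrec : forall n d, sum_f_R0 (fun k => q ^ k * Rmin 1 (B ^ k * d)) (S n)
  = Rmin 1 d + q * sum_f_R0 (fun k => q ^ k * Rmin 1 (B ^ k * (B * d))) n).
{ intros m e; rewrite decomp_sum by lia; rewrite scal_sum; simpl pred.
  rewrite !pow_O, !Rmult_1_l; f_equal; apply sum_eq; intros k _; simpl.
  replace (B ^ k * (B * e)) with (B * B ^ k * e) by ring; ring. }
assert (Hbig : forall n d, sum_f_R0 (fun k => q ^ k * Rmin 1 (B ^ k * d)) n <= / (1 - q)).
{ clear n d; induction n as [|n IH]; intros d.
  - simpl; rewrite !Rmult_1_l; pose proof (Rmin_l 1 d); lra.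
  - rewrite Hrec; pose proof (Rmin_l 1 d); specialize (IH (B * d)).
    assert (q * / (1 - q) = / (1 - q) - 1) by (field; lra); nra. }
(* Origin of the two summands of [modulus_const]: [1/(1 - q)] is the full series when every minimum
   is 1, and [B/(q B - 1)] pays for the subtracted term as long as [d <= B]. *)
assert (Hlarge : forall d, 1 <= d <= B ->
  / (1 - q) <= modulus_const * Rpower d alpha - d / (q * B - 1)).
{ clear d; intros d Hd.
  assert (1 <= Rpower d alpha)
    by (rewrite <- (Rpower_O d) by lra; apply Rle_Rpower; lra).
  pose proof modulus_const_pos as HC; unfold modulus_const, Rdiv in *; nra. }
revert d; induction n as [|n IH]; intros d Hd.
- destruct (Rle_lt_dec 1 d) as [Hd1|Hd1].
  + eapply Rle_trans; [apply Hbig | apply Hlarge; lra].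
  + pose proof (Rpower_between d alpha ltac:(lra) Halpha).
    simpl; rewrite !Rmult_1_l; pose proof (Rmin_r 1 d).
    assert (2 * / (q * B - 1) + 1 <= modulus_const)
      by (unfold modulus_const, Rdiv; nra).
    unfold Rdiv; nra.
- destruct (Rle_lt_dec 1 d) as [Hd1|Hd1].
  + eapply Rle_trans; [apply Hbig | apply Hlarge; lra].
  + rewrite Hrec; pose proof (Rmin_r 1 d).
    (* Here [d < 1], so [B * d] stays in [(0, B]]; this is why the bound is not stated on [(0, 1]]
       alone. *)
    specialize (IH (B * d) ltac:(nra)).
    assert (q * (modulus_const * Rpower (B * d) alpha - B * d / (q * B - 1))
      = modulus_const * Rpower d alpha - d / (q * B - 1) - d)
      by (rewrite <- (q_Rpower_mul d) by lra; field; lra).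
    nra.
Qed.

Lemma ex_series_modulus (d : R) : 0 < d -> ex_series (fun k => q ^ k * Rmin 1 (B ^ k * d)).
Proof.
intros Hd; pose proof base_ge_2; apply (ex_series_geom_bounded q 1); [apply q_bounds|].
intros k; assert (0 < B ^ k) by (apply pow_lt; lra).
rewrite Rabs_pos_eq; [apply Rmin_l | apply Rmin_glb; nra].
Qed.

Lemma modulus_series (d : R) :
  0 < d <= 1 ->
  Series (fun k => q ^ k * Rmin 1 (B ^ k * d)) <= modulus_const * Rpower d alpha.
Proof.
intros Hd; pose proof base_ge_2; pose proof qB_gt_1.
apply Series_le_bound; [apply ex_series_modulus; lra|].
intros n; pose proof (modulus_partial_sum n d ltac:(lra)).
assert (0 < d / (q * B - 1)) by (apply Rdiv_lt_0_compat; lra); lra.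
Qed.

(** * Hölder and separation estimates for the teeth *)

Lemma ex_series_tooth (M i : nat) (x : R) :
  1 <= INR M -> ex_series (fun k => q ^ k * tooth M i (B ^ k * x)).
Proof.
intros HM; apply (ex_series_geom_bounded q 1); [apply q_bounds|].
intros k; pose proof (tooth_bounds M i (B ^ k * x) HM); apply Rabs_le; lra.
Qed.

Lemma W_tooth_diff (M i : nat) (u v : R) :
  1 <= INR M ->
  W alpha b (tooth M i) v - W alpha b (tooth M i) u
  = Series (fun k => q ^ k * (tooth M i (B ^ k * v) - tooth M i (B ^ k * u))).
Proof.
intros HM; rewrite !W_eq, <- Series_minus by now apply ex_series_tooth.
apply Series_ext; intros k; ring.
Qed.

Lemma tooth_term_diff (M i k : nat) (u v : R) :
  1 <= INR M -> u < v ->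
  - Rmin 1 (B ^ k * (v - u)) <= tooth M i (B ^ k * v) - tooth M i (B ^ k * u)
    <= INR M * Rmin 1 (B ^ k * (v - u)).
Proof.
intros HM Huv; pose proof base_ge_2.
assert (0 < B ^ k) by (apply pow_lt; lra).
rewrite Rmult_minus_distr_l; apply tooth_diff; [easy | nra].
Qed.

(** Each term is at most [M] times that of the modulus sum; the factor [M] is harmless, being fixed
    before the points. *)
Lemma W_tooth_holder (M i : nat) (u v : R) :
  1 <= INR M -> 0 < v - u <= 1 ->
  Rabs (W alpha b (tooth M i) v - W alpha b (tooth M i) u)
    <= INR M * modulus_const * Rpower (v - u) alpha.
Proof.
intros HM Huv; rewrite W_tooth_diff by easy.
pose proof base_ge_2; pose proof q_bounds.
pose proof (ex_series_modulus (v - u) ltac:(lra)) as Ex.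
assert (Hterm : forall k,
  0 <= Rabs (q ^ k * (tooth M i (B ^ k * v) - tooth M i (B ^ k * u)))
    <= INR M * (q ^ k * Rmin 1 (B ^ k * (v - u)))).
{ intros k; split; [apply Rabs_pos|].
  assert (0 < q ^ k) by (apply pow_lt; lra).
  assert (0 < B ^ k) by (apply pow_lt; lra).
  pose proof (tooth_term_diff M i k u v HM ltac:(lra)).
  assert (0 <= Rmin 1 (B ^ k * (v - u))) by (apply Rmin_glb; nra).
  rewrite Rabs_mult, (Rabs_pos_eq (q ^ k)) by lra.
  rewrite (Rmult_comm (INR M)), Rmult_assoc.
  apply Rmult_le_compat_l; [lra | apply Rabs_le; nra]. }
assert (Ex' := ex_series_scal_l (INR M) _ Ex).
eapply Rle_trans; [apply Series_Rabs|].
- refine (@ex_series_le R_AbsRing R_CompleteNormedModule _ _ _ Ex').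
  intros k; unfold norm; simpl; unfold abs; simpl.
  rewrite Rabs_Rabsolu; apply Hterm.
- eapply Rle_trans; [apply Series_le; [exact Hterm | exact Ex'] |].
  rewrite Series_scal_l, Rmult_assoc.
  apply Rmult_le_compat_l; [lra | apply modulus_series; lra].
Qed.

(** Adding the modulus series to the difference makes every term nonnegative, so the sum is at least
    its [j]-th term. There the jump [1 - B^j (v - u)] and the added [B^j (v - u)] make up a full
    [q^j]. *)
Lemma W_tooth_lower (M i j : nat) (u v : R) :
  1 <= INR M -> 0 < v - u <= 1 -> B ^ j * (v - u) <= 1 ->
  1 - B ^ j * (v - u) <= tooth M i (B ^ j * v) - tooth M i (B ^ j * u) ->
  q ^ j - modulus_const * Rpower (v - u) alpha
    <= W alpha b (tooth M i) v - W alpha b (tooth M i) u.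
Proof.
intros HM Huv Hj Hjump; rewrite W_tooth_diff by easy.
pose proof q_bounds.
pose proof (ex_series_modulus (v - u) ltac:(lra)) as Ex.
assert (Ex' : ex_series (fun k => q ^ k * (tooth M i (B ^ k * v) - tooth M i (B ^ k * u)))).
{ apply (ex_series_geom_bounded q 1); [easy|]; intros k.
  pose proof (tooth_bounds M i (B ^ k * v) HM).
  pose proof (tooth_bounds M i (B ^ k * u) HM); apply Rabs_le; lra. }
pose proof (modulus_series (v - u) ltac:(lra)) as Hmod.
pose proof (le_Series _ j (ex_series_plus _ _ Ex' Ex)) as Hle.
rewrite Series_plus in Hle by easy.
unfold plus in Hle; simpl in Hle.
rewrite (Rmin_right 1 (B ^ j * (v - u))) in Hle by easy.
assert (0 < q ^ j) by (apply pow_lt; lra).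
cut (q ^ j <= q ^ j * (tooth M i (B ^ j * v) - tooth M i (B ^ j * u))
       + q ^ j * (B ^ j * (v - u))).
{ intros Hq; enough (Hpos : forall k, 0 <= q ^ k * (tooth M i (B ^ k * v) - tooth M i (B ^ k * u))
    + q ^ k * Rmin 1 (B ^ k * (v - u))) by (specialize (Hle Hpos); lra).
  intros k; assert (0 < q ^ k) by (apply pow_lt; lra).
  pose proof (tooth_term_diff M i k u v HM ltac:(lra)); nra. }
nra.
Qed.

(** Here [q^j = (B^j)^(-alpha)], and [1/B^j >= d/s]. *)
Lemma q_pow_ge (s d : R) (j : nat) :
  0 < s -> 0 < d -> B ^ j * d <= s -> Rpower (/ s) alpha * Rpower d alpha <= q ^ j.
Proof.
intros Hs Hd Hj; pose proof base_ge_2.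
assert (HBj : 0 < B ^ j) by (apply pow_lt; lra).
assert (His : 0 < / s) by now apply Rinv_0_lt_compat.
rewrite Rpower_mult_distr by lra.
unfold q; rewrite <- Rpower_pow_base by lra.
replace (- alpha * INR j) with (- INR j * alpha) by ring.
rewrite <- Rpower_mult, Rpower_Ropp, Rpower_pow by lra.
apply Rle_Rpower_l; [lra|]; split; [nra|].
apply (Rmult_le_reg_l (s * B ^ j)); [nra|].
replace (s * B ^ j * (/ s * d)) with (B ^ j * d) by (field; lra).
replace (s * B ^ j * / B ^ j) with s by (field; lra); lra.
Qed.

Lemma W_tooth_separates (M : nat) (u v : R) :
  2 * B <= INR M -> modulus_const + 1 <= Rpower (INR M / (2 * B)) alpha ->
  0 < v - u <= 1 -> v - u < 2 / INR M ->
  exists i, (i < M)%nat /\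
    Rpower (v - u) alpha <= W alpha b (tooth M i) v - W alpha b (tooth M i) u.
Proof.
intros HM HC Huv Hsmall; pose proof base_ge_2.
(* The window [[2/M, 2B/M)] for [B^j (v - u)] ends no later than 1, as [W_tooth_lower] requires. *)
assert (Hs1 : B * (2 / INR M) <= 1).
{ apply (Rmult_le_reg_r (INR M)); [lra|].
  replace (B * (2 / INR M) * INR M) with (2 * B) by (field; lra); lra. }
destruct (Pow_x_infinity B ltac:(rewrite Rabs_pos_eq; lra) (2 / INR M / (v - u))) as [N HN].
specialize (HN N (le_n N)).
rewrite Rabs_pos_eq in HN by (apply pow_le; lra).
destruct (scale_between B (2 / INR M) N (v - u)) as [j Hj]; [lra | easy | |].
{ replace (2 / INR M) with (2 / INR M / (v - u) * (v - u)) by (field; lra).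
  apply Rmult_le_compat_r; lra. }
destruct (tooth_jump M (B ^ j * u) (B ^ j * v)) as (i & Hi & Hjump);
  [lra | rewrite <- Rmult_minus_distr_l; lra |].
rewrite <- Rmult_minus_distr_l in Hjump.
exists i; split; [easy|].
eapply Rle_trans; [|apply (W_tooth_lower M i j); [lra | lra | lra | easy]].
assert (Hq : Rpower (/ (B * (2 / INR M))) alpha * Rpower (v - u) alpha <= q ^ j).
{ apply q_pow_ge; [| lra | lra].
  apply Rmult_lt_0_compat; [lra | apply Rdiv_lt_0_compat; lra]. }
replace (/ (B * (2 / INR M))) with (INR M / (2 * B)) in Hq by (field; lra).
(* With [C = modulus_const] and [d = v - u], the gain [q^j] is at least [(C + 1) d^alpha]; after the
   loss [C d^alpha] one [d^alpha] remains. *)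
assert (0 < Rpower (v - u) alpha) by apply exp_pos; nra.
Qed.

Lemma exists_resolution :
  exists M : nat, 2 * B <= INR M /\ modulus_const + 1 <= Rpower (INR M / (2 * B)) alpha.
Proof.
pose proof base_ge_2; pose proof modulus_const_pos.
set (t := Rpower (modulus_const + 1) (/ alpha)).
assert (Ht : 0 < t) by apply exp_pos.
(* In [1 + t] the summand 1 secures [2B <= M], and [t] secures [t <= M/(2B)]. *)
destruct (INR_unbounded (2 * B * (1 + t))) as [M HM].
exists M; split; [nra|].
replace (modulus_const + 1) with (Rpower t alpha).
- apply Rle_Rpower_l; [lra|]; split; [easy|].
  apply (Rmult_le_reg_r (2 * B)); [lra|].
  replace (INR M / (2 * B) * (2 * B)) with (INR M) by (field; lra); nra.
- unfold t; rewrite Rpower_mult, Rinv_l, Rpower_1; lra.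
Qed.

End WeierstrassSums.

(** * Regularity of the coboundaries and the embedding *)

Lemma coboundary_periodic (alpha : R) (b : nat) (h : R -> R) :
  periodic1 h -> periodic1 (coboundary alpha b h).
Proof.
intros Hh x; unfold coboundary.
now rewrite Hh, Rmult_plus_distr_l, Rmult_1_r, periodic1_INR.
Qed.

Lemma coboundary_lipschitz (alpha : R) (b : nat) (h : R -> R) :
  lipschitz h -> lipschitz (coboundary alpha b h).
Proof.
intros [L HL]; unfold coboundary; set (q := Rpower (INR b) (- alpha)).
exists (L + q * (L * INR b)); intros x y.
assert (Hq : 0 < q) by apply exp_pos.
replace (h x - q * h (INR b * x) - (h y - q * h (INR b * y)))
  with ((h x - h y) - q * (h (INR b * x) - h (INR b * y))) by ring.
eapply Rle_trans; [apply Rabs_triang|].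
rewrite Rabs_Ropp, Rabs_mult, (Rabs_pos_eq q) by lra.
rewrite Rmult_plus_distr_r; apply Rplus_le_compat; [apply HL|].
rewrite Rmult_assoc; apply Rmult_le_compat_l; [lra|].
eapply Rle_trans; [apply HL|].
rewrite <- Rmult_minus_distr_l, Rabs_mult, (Rabs_pos_eq (INR b)) by apply pos_INR.
right; ring.
Qed.

(** The distance is that of [R/Z], since continuous periodic functions nearly agree at points close
    to 0 and to 1. The condition [x <> y] excludes [Rpower 0 alpha], which is 1 by the convention
    [ln 0 = 0]. *)
Theorem theorem2p1 :
  forall (b : nat) (alpha : R),
    (2 <= b)%nat -> 0 < alpha < 1 ->
    exists (d : nat) (gs : nat -> R -> R),
      (forall i, (i < d)%nat -> periodic1 (gs i) /\ lipschitz (gs i)) /\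
      exists c1 c2 : R, 0 < c1 /\ 0 < c2 /\
        forall x y : R, 0 <= x < 1 -> 0 <= y < 1 -> x <> y ->
          c1 * Rpower (circ_dist x y) alpha
            <= linf d (fun i => Phi alpha b gs x i - Phi alpha b gs y i)
          /\ linf d (fun i => Phi alpha b gs x i - Phi alpha b gs y i)
            <= c2 * Rpower (circ_dist x y) alpha.
Proof.
intros b alpha Hb Halpha.
destruct (exists_resolution b alpha Hb Halpha) as (M & HM & HC).
pose proof (base_ge_2 b Hb) as HB.
pose proof (modulus_const_pos b alpha Hb Halpha) as HCpos.
set (C := modulus_const b alpha) in *.
(* The first [M] coordinates separate points closer than [2/M]; the last [M] have the teeth
   themselves as Weierstrass functions and separate the other points. *)
set (gs := fun i => if Nat.ltb i M then tooth M i
                    else coboundary alpha b (tooth M (i - M))).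
assert (Hgs1 : forall i, (i < M)%nat -> gs i = tooth M i)
  by (intros i Hi; unfold gs; apply Nat.ltb_lt in Hi; now rewrite Hi).
assert (Hgs2 : forall i, gs (M + i)%nat = coboundary alpha b (tooth M i)).
{ intros i; unfold gs.
  destruct (Nat.ltb_spec (M + i) M); [lia | do 2 f_equal; lia]. }
assert (HW2 : forall i x, W alpha b (gs (M + i)%nat) x = tooth M i x).
{ intros i x; rewrite Hgs2; apply (W_coboundary b alpha Hb Halpha _ 1).
  intros z; pose proof (tooth_bounds M i z ltac:(lra)); apply Rabs_le; lra. }
assert (Hlip : forall i, lipschitz (tooth M i)).
{ intros i; exists (INR M); intros x y; apply tooth_Lip; lra. }
assert (Hper : forall i, periodic1 (gs i)).
{ intros i; unfold gs; destruct Nat.ltb;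
    [|apply coboundary_periodic]; apply tooth_periodic. }
exists (M + M)%nat, gs; split.
{ intros i _; split; [apply Hper|].
  unfold gs; destruct Nat.ltb; [|apply coboundary_lipschitz]; apply Hlip. }
(* Close points give the lower constant 1; for the others a tooth gains [1 - (v - u) >= 1/2], while
   [(v - u)^alpha < 1]. For the upper bound the first coordinates need [M C] and the last ones [M],
   by [v - u <= (v - u)^alpha]. *)
exists (1 / 2), (INR M * (C + 1)); split; [lra|]; split; [nra|].
intros x y Hx Hy Hxy.
destruct (circ_dist_lift x y Hx Hy Hxy) as (u & v & Huv & -> & Hf).
assert (HPhi : forall i, Rabs (Phi alpha b gs x i - Phi alpha b gs y i)
                         = Rabs (W alpha b (gs i) v - W alpha b (gs i) u))
  by (intros i; apply Hf, W_periodic, Hper).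
pose proof (Rpower_between (v - u) alpha ltac:(lra) Halpha) as Hpow.
split.
- destruct (Rlt_le_dec (v - u) (2 / INR M)) as [Hd | Hd].
  + destruct (W_tooth_separates b alpha Hb Halpha M u v HM HC ltac:(lra) Hd)
      as (i & Hi & Hle).
    eapply Rle_trans; [|apply Rabs_le_linf with (i := i); lia].
    cbv beta; rewrite HPhi, Hgs1 by easy.
    eapply Rle_trans; [|apply Rle_abs]; lra.
  + destruct (tooth_jump M u v ltac:(lra) Hd) as (i & Hi & Hle).
    eapply Rle_trans; [|apply Rabs_le_linf with (i := (M + i)%nat); lia].
    cbv beta; rewrite HPhi, !HW2.
    eapply Rle_trans; [|apply Rle_abs]; lra.
- apply linf_le; [repeat apply Rmult_le_pos; lra|]; intros i Hi; rewrite HPhi.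
  destruct (Nat.lt_ge_cases i M) as [HiM | HiM].
  + rewrite Hgs1 by easy.
    eapply Rle_trans; [apply W_tooth_holder; try easy; lra|].
    fold C; apply Rmult_le_compat_r; [lra|].
    apply Rmult_le_compat_l; lra.
  + replace i with (M + (i - M))%nat by lia; rewrite !HW2.
    eapply Rle_trans; [apply tooth_Lip; lra|].
    rewrite Rabs_pos_eq by lra.
    rewrite Rmult_assoc; apply Rmult_le_compat_l; nra.
Qed.
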